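(* Let $(k,n)$ be a pair of integers such that $3\le k\le n$ and $n\ge 6$. Then there exists a connected graph $G$ such that $|V(G)|=n$, $\Delta(G)=n-3$, $\gamma(G)=3$ and $\gamma_{11}(G)=k$ if and only if $(k,n)\notin\{(4,6),(5,6),(6,6),(5,7),(6,7),(7,7),(8,8)\}$.
   Context: All graphs are finite, undirected, simple and connected. $\Delta(G)$ is the maximum degree of $G$. A set $S\subseteq V(G)$ is a dominating set if every vertex not in $S$ is adjacent to at least one vertex of $S$; the domination number $\gamma(G)$ is the minimum cardinality of a dominating set. A set $S\subseteq V(G)$ is a perfect dominating set if every vertex not in $S$ is adjacent to exactly one vertex of $S$ (in particular $S=V(G)$ is allowed); the perfect domination number $\gamma_{11}(G)$ is the minimum cardinality of a perfect dominating set. *)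

(* Defs.v *)
From HB Require Import structures.
From mathcomp Require Import all_boot.

Set Implicit Arguments.
Unset Strict Implicit.
Unset Printing Implicit Defensive.

Record sgraph := SGraph {
  vertex :> finType;
  adj : rel vertex;
  adj_sym : symmetric adj;
  adj_irrefl : irreflexive adj
}.

Section Graph.
Variable G : sgraph.
Implicit Types (S : {set G}) (v : G).

Definition nbh v : {set G} := [set u | adj v u].

Definition max_degree : nat := \max_(v : G) #|nbh v|.

(* The graph without vertices also satisfies this predicate. *)
Definition connected_graph : Prop := forall u v : G, connect (@adj G) u v.

Definition dominating S : bool :=
  [forall v, (v \notin S) ==> (0 < #|nbh v :&: S|)].

Definition perfect_dominating S : bool :=
  [forall v, (v \notin S) ==> (#|nbh v :&: S| == 1)].

(* Both families contain the whole vertex set, which is therefore a legitimate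
   starting point for the minimisation; see the two lemmas below. *)
Definition gamma : nat :=
  #|[arg min_(S < [set: G] | dominating S) #|S| ]|.

Definition gamma11 : nat :=
  #|[arg min_(S < [set: G] | perfect_dominating S) #|S| ]|.

Lemma dominatingT : dominating [set: G].
Proof. by apply/forallP => v; rewrite in_setT. Qed.

Lemma perfect_dominatingT : perfect_dominating [set: G].
Proof. by apply/forallP => v; rewrite in_setT. Qed.

End Graph.

(* Main.v *)
Require Import Defs.
From mathcomp Require Import all_boot.
From mathcomp Require Import zify.

Set Implicit Arguments.
Unset Strict Implicit.
Unset Printing Implicit Defensive.

(** Write m = n - 3 and let v be a vertex of degree m.  Exactly two vertices, the
    poles, are not adjacent to v.  If gamma = 3, no pair of vertices dominates;
    the pairs containing v show that the poles are not adjacent and have no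
    common neighbour.  So G is a hub v joined to m rim vertices, each of which
    carries a label: the pole it is adjacent to, or None.  What remains free is
    the labelling and the graph induced on the rim ([hub_graph],
    [hub_normal_form]).  For such a graph, gamma = 3 amounts to two conditions
    on the rim: a pole with a rim vertex of the other label misses something
    ([side_missed]), and so do two rim vertices of different pole labels
    ([cross_missed]).

    Perfect dominating sets of a hub graph come in two kinds.  Without the hub,
    the set must contain exactly one rim vertex z, and the two conditions above
    force both poles in: it is both poles and z, where the rim neighbours of z
    are precisely the other unlabelled rim vertices ([focal]).  With the hub,
    every rim vertex outside the set already has its unique neighbour, so the
    rim part W is a union of components of the rim graph; each pole is then
    either outside, with exactly one neighbour in W, or inside, with all its
    neighbours in W ([admissible], [weight]).  Hence gamma11 is 3 if a focal
    vertex exists, and the least weight of an admissible W otherwise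
    ([focal_perfect], [admissible_perfect], [perfect_weight]).

    Nonexistence concerns m = 3, 4, 5 only, and says that gamma11 is at most 3,
    4, 7 respectively.  After sorting the rim by label this is a finite
    verification over all rim graphs ([small_gamma11]).

    Existence uses two rim graphs: a star with isolated vertices, and a
    spider, i.e. a spanning star with one leg of length two.
    - k = 3: no rim edges and a single unlabelled vertex, which is focal.
    - 4 <= k <= n - 2: one rim vertex attached to each pole, both in a component
      of size k - 1; then W must contain that component and may equal it.
    - k = n - 1 and k = n: the rim graph is the connected spider, so W is the
      whole rim, and a pole with at least two neighbours must be taken; one pole
      (resp. no pole) has a single neighbour. *)

(** * Extremal sets *)

Lemma gamma_le (G : sgraph) (S : {set G}) : dominating S -> gamma G <= #|S|.
Proof.
by rewrite /gamma; case: arg_minnP => [|T _ minT /minT //]; apply: dominatingT.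
Qed.

Lemma gamma_witness (G : sgraph) :
  exists2 S : {set G}, dominating S & #|S| = gamma G.
Proof.
rewrite /gamma; case: arg_minnP => [|S domS _]; first exact: dominatingT.
by exists S.
Qed.

Lemma gamma11_le (G : sgraph) (S : {set G}) :
  perfect_dominating S -> gamma11 G <= #|S|.
Proof.
rewrite /gamma11; case: arg_minnP => [|T _ minT /minT //].
exact: perfect_dominatingT.
Qed.

Lemma gamma11_witness (G : sgraph) :
  exists2 S : {set G}, perfect_dominating S & #|S| = gamma11 G.
Proof.
rewrite /gamma11; case: arg_minnP => [|S domS _]; first exact: perfect_dominatingT.
by exists S.
Qed.

Lemma gamma_le_gamma11 (G : sgraph) : gamma G <= gamma11 G.
Proof.
have [S perS <-] := gamma11_witness G; apply/gamma_le/forallP => v.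
by apply/implyP => /(implyP (forallP perS v)) /eqP ->.
Qed.

Lemma pair_not_dominating (G : sgraph) (x y : G) :
  2 < gamma G -> exists z, [/\ z != x, z != y, ~~ adj x z & ~~ adj y z].
Proof.
move=> gt2; have /forallPn[z] : ~~ dominating [set x; y].
  apply/negP => /gamma_le; rewrite cards2; lia.
rewrite negb_imply !inE negb_or -leqNgt leqn0 cards_eq0.
case/andP=> /andP[zx zy] /eqP N0; exists z; split=> //; apply/negP => a.
  by have := in_set0 x; rewrite -N0 !inE eqxx adj_sym a.
by have := in_set0 y; rewrite -N0 !inE eqxx orbT adj_sym a.
Qed.

Section Transport.
Variables (G H : sgraph) (phi : H -> G).
Hypotheses (phi_bij : bijective phi) (phi_adj : {mono phi : x y / adj x y}).

Lemma perfect_dominating_image (S : {set H}) :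
  perfect_dominating S -> perfect_dominating (phi @: S).
Proof.
have [psi phiK psiK] := phi_bij; have phi_inj := bij_inj phi_bij.
move=> /forallP perS; apply/forallP => v; rewrite -[v]psiK mem_imset //.
apply/implyP => /(implyP (perS _)) /eqP <-; rewrite -(card_imset _ phi_inj).
apply/eqP/eq_card => u; rewrite -[u]psiK mem_imset //.
by rewrite !inE phi_adj mem_imset.
Qed.

Lemma gamma11_transport_le (S : {set H}) :
  perfect_dominating S -> gamma11 G <= #|S|.
Proof.
move=> /perfect_dominating_image /gamma11_le.
by rewrite card_imset //; apply: bij_inj.
Qed.

End Transport.

(** * Hub graphs *)

(** Symmetrising from the pairs i < j makes any [rel nat] describe a simple
    graph, with no proof obligations. *)
Definition link (h : rel nat) i j := (i < j) && h i j || (j < i) && h j i.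

Lemma linkC h i j : link h i j = link h j i.
Proof. by rewrite /link orbC. Qed.

Lemma linkii h i : link h i i = false.
Proof. by rewrite /link ltnn. Qed.

(** [inl None] is the hub, [inl (Some s)] the pole of side s, and [inr i] the
    rim vertex i. *)
Definition hub_vertex m : finType := (option bool + 'I_m)%type.

Section HubGraph.
Variables (m : nat) (h : rel nat) (lab : nat -> option bool).

Definition hub_adj (x y : hub_vertex m) : bool :=
  match x, y with
  | inl _, inl _ => false
  | inl o, inr i | inr i, inl o => (o == None) || (lab i == o)
  | inr i, inr j => link h i j
  end.

Lemma hub_adj_sym : symmetric hub_adj.
Proof. by case=> [o|i] [o'|j] //=; rewrite linkC. Qed.

Lemma hub_adj_irrefl : irreflexive hub_adj.
Proof. by case=> [o|i] //=; rewrite linkii. Qed.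

Definition hub_graph := SGraph hub_adj_sym hub_adj_irrefl.

(** No pair consisting of a pole and a rim vertex attached to the other pole
    dominates.  Lists instead of finite types keep this and the following
    conditions computable. *)
Definition side_missed :=
  all (fun y => if lab y is Some s then
         has (fun z => [&& z != y, ~~ link h y z & lab z != Some (~~ s)])
             (iota 0 m)
       else true) (iota 0 m).

(** No pair consisting of a neighbour of each pole dominates. *)
Definition cross_missed :=
  all (fun x => (lab x == Some true) ==>
    all (fun y => (lab y == Some false) ==>
      has (fun z => [&& z != x, z != y, ~~ link h x z & ~~ link h y z])
          (iota 0 m))
    (iota 0 m)) (iota 0 m).

(** This is the condition for both poles together with z to be a perfect
    dominating set: the hub sees only z, a labelled rim vertex sees its pole, and
    an unlabelled one can only see z. *)
Definition focal z :=
  all (fun t => (t != z) ==> (link h z t == (lab t == None))) (iota 0 m).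

Definition lab_count (W : pred nat) s :=
  count (fun i => (lab i == Some s) && W i) (iota 0 m).

(** The rim parts of the perfect dominating sets containing the hub. *)
Definition admissible (W : pred nat) :=
  all (fun i => all (fun j => link h i j ==> (W i == W j)) (iota 0 m))
      (iota 0 m) &&
  all (fun s => (lab_count W s == 1)
             || all (fun i => (lab i == Some s) ==> W i) (iota 0 m))
      [:: true; false].

(** The cardinality of the smallest perfect dominating set that contains the hub
    and has rim part W: a pole is left out when it has exactly one neighbour
    in W. *)
Definition weight (W : pred nat) :=
  1 + (lab_count W true != 1) + (lab_count W false != 1) + count W (iota 0 m).

Lemma all_iotaP (P : pred nat) :
  reflect (forall i, i < m -> P i) (all P (iota 0 m)).
Proof.
apply: (iffP allP) => P_ i; first by move=> lt_i; apply: P_; rewrite mem_iota.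
by rewrite mem_iota => /P_.
Qed.

Lemma has_iotaP (P : pred nat) :
  reflect (exists2 i, i < m & P i) (has P (iota 0 m)).
Proof.
by apply: (iffP hasP) => -[i]; rewrite ?mem_iota => ? ?; exists i;
  rewrite ?mem_iota.
Qed.

Lemma side_missedP :
  reflect (forall y s, y < m -> lab y = Some s ->
            exists z, [/\ z < m, z != y, ~~ link h y z & lab z != Some (~~ s)])
          side_missed.
Proof.
apply: (iffP (all_iotaP _)) => miss y.
  move=> s /miss + laby; rewrite laby => /has_iotaP[z ltz /and3P[]].
  by exists z; split.
move=> lty; case laby: (lab y) => [s|//].
have [z [ltz zy nyz labz]] := miss y s lty laby.
by apply/has_iotaP; exists z => //; apply/and3P.
Qed.

Lemma cross_missedP :
  reflect (forall x y, x < m -> y < m -> lab x = Some true ->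
             lab y = Some false ->
             exists z, [/\ z < m, z != x, z != y, ~~ link h x z & ~~ link h y z])
          cross_missed.
Proof.
apply: (iffP (all_iotaP _)) => miss x.
  move=> y ltx lty /eqP labx /eqP laby.
  have /all_iotaP/(_ y lty) := implyP (miss x ltx) labx.
  by rewrite laby => /has_iotaP[z ltz /and4P[]]; exists z; split.
move=> ltx; apply/implyP => /eqP labx; apply/all_iotaP => y lty.
apply/implyP => /eqP laby; have [z [ltz *]] := miss x y ltx lty labx laby.
by apply/has_iotaP; exists z => //; apply/and4P.
Qed.

Lemma focalP z :
  reflect (forall t, t < m -> t != z -> link h z t = (lab t == None)) (focal z).
Proof.
apply: (iffP (all_iotaP _)) => foc t lt; first by move/(implyP (foc t lt))/eqP.
by apply/implyP => tz; rewrite foc.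
Qed.

Lemma admissibleP W :
  reflect ((forall i j, i < m -> j < m -> link h i j -> W i = W j) /\
           (forall s, lab_count W s = 1 \/
                      forall i, i < m -> lab i = Some s -> W i))
          (admissible W).
Proof.
apply: (iffP andP) => -[clW cntW]; split.
- move=> i j lti ltj lij; apply/eqP.
  by have /all_iotaP/(_ j ltj)/implyP/(_ lij) := elimT (all_iotaP _) clW i lti.
- move=> s; have: s \in [:: true; false] by case: s.
  case/(allP cntW)/orP=> [/eqP|/all_iotaP sub]; [by left | right=> i lti labi].
  by have := sub i lti; rewrite labi eqxx.
- apply/all_iotaP => i lti; apply/all_iotaP => j ltj; apply/implyP => lij.
  by rewrite (clW i j).
- apply/allP => s _; case: (cntW s) => [->|sub] //; apply/orP; right.
  by apply/all_iotaP => i lti; apply/implyP => /eqP; apply: sub.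
Qed.

(** Every vertex set is given by its trace on hub and poles and its trace on the
    rim ([hub_setE]).  In these coordinates the sets nbh x :&: S are again of
    this form, so domination turns into arithmetic of counts. *)
Definition hub_set (P : pred (option bool)) (W : pred nat) : {set hub_graph} :=
  [set x : hub_vertex m | match x with inl o => P o | inr i => W i end].

Definition rim_trace (S : {set hub_graph}) (i : nat) :=
  [exists o : 'I_m, (o == i :> nat) && ((inr o : hub_vertex m) \in S)].

Lemma rim_traceE S (i : 'I_m) : rim_trace S i = ((inr i : hub_vertex m) \in S).
Proof.
apply/existsP/idP => [[o /andP[/eqP/val_inj -> //]]|Si].
by exists i; rewrite eqxx.
Qed.

Lemma hub_setE (S : {set hub_graph}) :
  S = hub_set (fun o => (inl o : hub_vertex m) \in S) (rim_trace S).
Proof. by apply/setP=> -[o|i]; rewrite !inE ?rim_traceE. Qed.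

Lemma card_hub_set P W :
  #|hub_set P W| =
  P None + P (Some true) + P (Some false) + count W (iota 0 m).
Proof.
rewrite -sum1_card big_sumType /= big_mkcond [X in _ + X]big_mkcond /=.
congr (_ + _).
  rewrite (bigD1 None) // (bigD1 (Some true)) // (bigD1 (Some false)) //=.
  rewrite big1 => [|[[]|] //]; rewrite !inE !addn0 addnA.
  by case: (P None) (P (Some true)) (P (Some false)) => [] [] [].
rewrite -sum1_count [RHS]big_mkcond /= -[in RHS](subn0 m) -/(index_iota 0 m).
by rewrite big_mkord; apply: eq_bigr => i _; rewrite !inE.
Qed.

Lemma nbh_inl P W o :
  nbh (inl o : hub_graph) :&: hub_set P W =
  hub_set pred0 (fun i => ((o == None) || (lab i == o)) && W i).
Proof. by apply/setP=> -[o'|i]; rewrite !inE. Qed.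

Lemma nbh_inr P W (i : 'I_m) :
  nbh (inr i : hub_graph) :&: hub_set P W =
  hub_set (fun o => ((o == None) || (lab i == o)) && P o)
          (fun j => link h i j && W j).
Proof. by apply/setP=> -[o'|j]; rewrite !inE. Qed.

Definition rim_degree (P : pred (option bool)) (W : pred nat) i :=
  P None + ((lab i == Some true) && P (Some true)) +
  ((lab i == Some false) && P (Some false)) +
  count (fun j => link h i j && W j) (iota 0 m).

(** Domination and perfect domination differ only in the test c on the number of
    neighbours in the set, so both are translated at once. *)
Lemma dominating_by (c : pred nat) P W :
  (forall v, (v \notin hub_set P W) ==> c #|nbh v :&: hub_set P W|) <->
  [/\ P None \/ c (count W (iota 0 m)),
      forall s, P (Some s) \/ c (lab_count W s) &
      forall i, i < m -> W i \/ c (rim_degree P W i)].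
Proof.
split=> [dom|[dN dS dW] [[s|]|i]].
- split=> [|s|i lti].
  + have := dom (inl None); rewrite nbh_inl card_hub_set !inE /= add0n.
    by case: (P None) => /=; [left | right].
  + have := dom (inl (Some s)); rewrite nbh_inl card_hub_set !inE /= add0n.
    by case: (P (Some s)) => /=; [left | right].
  + have := dom (inr (Ordinal lti)); rewrite nbh_inr card_hub_set !inE /=.
    by case: (W i) => /=; [left | right].
- rewrite nbh_inl card_hub_set !inE /= add0n.
  by apply/implyP => /negPf NP; case: (dS s) => //; rewrite NP.
- rewrite nbh_inl card_hub_set !inE /= add0n.
  by apply/implyP => /negPf NP; case: dN => //; rewrite NP.
- rewrite nbh_inr card_hub_set !inE.
  by apply/implyP => /negPf NW; case: (dW i) => //; rewrite NW.
Qed.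

Lemma dominatingP P W :
  dominating (hub_set P W) <->
  [/\ P None \/ 0 < count W (iota 0 m),
      forall s, P (Some s) \/ 0 < lab_count W s &
      forall i, i < m -> W i \/ 0 < rim_degree P W i].
Proof.
have [to from] := dominating_by (leq 1) P W.
by split=> [/forallP/to|/from/forallP].
Qed.

Lemma perfect_dominatingP P W :
  perfect_dominating (hub_set P W) <->
  [/\ P None \/ count W (iota 0 m) = 1,
      forall s, P (Some s) \/ lab_count W s = 1 &
      forall i, i < m -> W i \/ rim_degree P W i = 1].
Proof.
have [to from] := dominating_by (fun n => n == 1) P W.
split=> [/forallP/to[dN dS dW]|[dN dS dW]].
  by split=> [|s|i /dW[]]; [case: dN | case: (dS s) |..];
     try (by left); right; apply/eqP.
apply/forallP/from; split=> [|s|i /dW[|/eqP]]; try (by left); try (by right).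
  by case: dN => [|/eqP]; [left | right].
by case: (dS s) => [|/eqP]; [left | right].
Qed.

Lemma count_ge (s : seq nat) (W : pred nat) :
  uniq s -> (forall i, i \in s -> i < m /\ W i) -> size s <= count W (iota 0 m).
Proof.
move=> us sW; rewrite -size_filter uniq_leq_size // => i /sW[lti Wi].
by rewrite mem_filter Wi mem_iota.
Qed.

Lemma count_at (b : pred nat) z :
  z < m -> count (fun j => b j && (j == z)) (iota 0 m) = b z.
Proof.
move=> ltz; case bz: (b z); last first.
  rewrite (@eq_count _ _ pred0) ?count_pred0 // => j.
  by rewrite /=; case: eqP => [->|]; rewrite ?bz ?andbF.
rewrite (@eq_count _ _ (pred1 z)) => [|j].
  by rewrite count_uniq_mem ?iota_uniq // mem_iota ltz.
by rewrite /=; case: eqP => [->|]; rewrite ?bz ?andbF.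
Qed.

Lemma count_gt0P (W : pred nat) :
  0 < count W (iota 0 m) -> exists2 i, i < m & W i.
Proof. by rewrite -has_count => /has_iotaP. Qed.

End HubGraph.

(** * Domination, degrees and connectedness of hub graphs *)

Section HubDomination.
Variables (m : nat) (h : rel nat) (lab : nat -> option bool).
Local Notation G := (hub_graph m h lab).
Local Notation hset P W := (@hub_set m h lab P W).

Lemma rim_degree_gt0 P W i : 0 < rim_degree m h lab P W i ->
  [\/ P None, exists2 s, lab i = Some s & P (Some s)
    | exists j, [/\ j < m, link h i j & W j]].
Proof.
rewrite /rim_degree !addn_gt0 !lt0b -!orbA.
case/or4P=> [|/andP[/eqP]|/andP[/eqP]|/count_gt0P[j ltj /andP[]]].
- by constructor 1.
- by constructor 2; exists true.
- by constructor 2; exists false.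
- by constructor 3; exists j; split.
Qed.

Hypotheses (side : side_missed m h lab) (cross : cross_missed m h lab).

(** The closed neighbourhoods of the two poles are disjoint and a dominating set
    meets both.  If it does so in the two poles, the hub costs a third element;
    if in a pole and a rim vertex, or in two rim vertices, the vertex z
    provided by the hypotheses does. *)
Lemma dominating_hub_ge3 P W : dominating (hset P W) -> 2 < #|hset P W|.
Proof.
case/dominatingP=> dN dS dW; rewrite card_hub_set.
have two s : P (Some s) -> ~~ P (Some (~~ s)) ->
    2 < P None + 1 + count W (iota 0 m).
  move=> Ps nPs; have [|/count_gt0P[y lty /andP[/eqP laby Wy]]] := dS (~~ s).
    by rewrite (negPf nPs).
  have [z [ltz zy nyz labz]] := side_missedP _ _ _ side y _ lty laby.
  have W2 w : w < m -> W w -> w != y -> 1 < count W (iota 0 m).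
    move=> ltw Ww wy; apply: (@count_ge m [:: w; y]) => /= [|i].
      by rewrite inE wy.
    by rewrite !inE => /orP[] /eqP->.
  have W1 : 0 < count W (iota 0 m).
    by apply: (@count_ge m [:: y]) => // i; rewrite inE => /eqP->.
  have [Wz|/rim_degree_gt0[PN|[s' labz' Ps']|[w [ltw zw Ww]]]] := dW z ltz.
  - by move: (W2 z ltz Wz zy); clear; lia.
  - by rewrite PN; move: W1; clear; lia.
  - have s's : s' = ~~ s.
      by apply/eqP; apply: contraNT labz; rewrite labz'; case: (s) (s') => [] [].
    by rewrite s's (negPf nPs) in Ps'.
  - have wy : w != y by apply: contraNneq nyz => <-; rewrite linkC.
    by move: (W2 w ltw Ww wy); clear; lia.
case Pt: (P (Some true)); case Pf: (P (Some false)) => /=.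
- by case: dN => [->|]; lia.
- by have := two true Pt; rewrite Pf => /(_ isT); lia.
- by have := two false Pf; rewrite Pt => /(_ isT); lia.
have [|/count_gt0P[x ltx /andP[/eqP labx Wx]]] := dS true; first by rewrite Pt.
have [|/count_gt0P[y lty /andP[/eqP laby Wy]]] := dS false; first by rewrite Pf.
have [z [ltz zx zy nxz nyz]] := cross_missedP _ _ _ cross x y ltx lty labx laby.
have xy : x != y by apply/eqP => exy; move: laby; rewrite -exy labx.
have W3 w : w < m -> W w -> w != x -> w != y -> 2 < count W (iota 0 m).
  move=> ltw Ww wx wy; apply: (@count_ge m [:: w; x; y]) => /= [|i].
    by rewrite !inE negb_or wx wy xy.
  by rewrite !inE => /or3P[] /eqP->.
have W2 : 1 < count W (iota 0 m).
  apply: (@count_ge m [:: x; y]) => /= [|i]; first by rewrite inE xy.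
  by rewrite !inE => /orP[] /eqP->.
have [Wz|/rim_degree_gt0[PN|[s' _ Ps']|[w [ltw zw Ww]]]] := dW z ltz.
- by move: (W3 z ltz Wz zx zy); clear; lia.
- by rewrite PN; move: W2; clear; lia.
- by case: s' Ps'; rewrite ?Pt ?Pf.
- have wx : w != x by apply: contraNneq nxz => <-; rewrite linkC.
  have wy : w != y by apply: contraNneq nyz => <-; rewrite linkC.
  by move: (W3 w ltw Ww wx wy); clear; lia.
Qed.

Lemma gamma_hub : gamma G = 3.
Proof.
apply/eqP; rewrite eqn_leq; apply/andP; split.
  have <- : #|hset predT pred0| = 3 by rewrite card_hub_set count_pred0.
  by apply/gamma_le/dominatingP; split=> *; [left | left | right].
have [S] := gamma_witness G; rewrite [S]hub_setE => /dominating_hub_ge3.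
by move=> + <-.
Qed.

(** Each vertex has three vertices, itself included, outside its neighbourhood:
    for a labelled rim vertex these are itself, the other pole and the vertex
    missed by [side_missed]. *)
Lemma max_degree_hub : max_degree G = m.
Proof.
have card_nbh (v : G) (U : {set G}) :
    2 < #|U| -> [disjoint U & nbh v] -> #|nbh v| <= m.
  move=> cU dis; have := max_card (mem (U :|: nbh v)).
  rewrite cardsU disjoint_setI0 // cards0 card_sum card_option card_bool.
  by rewrite card_ord; lia.
have cV := card_nbh _ (hset predT pred0).
rewrite card_hub_set count_pred0 in cV.
apply/eqP; rewrite eqn_leq; apply/andP; split.
  apply/bigmax_leqP => -[o|i] _.
    apply: cV => //; apply/pred0P => -[o'|j] //=; rewrite !inE ?andbF //.
  case labi: (lab i) => [s|]; last first.
    pose Q := pred2 (Some true) (Some false).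
    apply: (card_nbh _ (hset Q (pred1 (i : nat)))).
      rewrite card_hub_set; apply: (@count_ge m [:: val i]) => // j.
      by rewrite inE => /eqP->; rewrite /= eqxx.
    apply/pred0P => -[[s|]|j] //=; rewrite !inE /= ?labi ?andbF //=.
    by apply/negP => /andP[/eqP->]; rewrite linkii.
  have [z [ltz zi niz _]] := side_missedP _ _ _ side i s (ltn_ord i) labi.
  apply: (card_nbh _ (hset (pred1 (Some (~~ s))) (pred2 (i : nat) z))).
    rewrite card_hub_set /= [X in X + _](_ : _ = 1); last by case: (s).
    apply: (@count_ge m [:: val i; z]) => /= [|j]; first by rewrite inE eq_sym zi.
    by rewrite !inE => /orP[] /eqP->; rewrite ?ltz ?eqxx ?orbT.
  apply/pred0P => -[[s'|]|j] //=; rewrite !inE /= ?labi ?andbF //=.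
    by case: (s) (s') => [] [].
  apply/negP => /andP[/orP[]/eqP -> ]; first by rewrite linkii.
  exact/negP.
apply: leq_trans (leq_bigmax (inl None : G)).
have -> : nbh (inl None : G) = hset pred0 predT by apply/setP=> -[o|i]; rewrite !inE.
by rewrite card_hub_set count_predT size_iota.
Qed.

Lemma connected_hub :
  (forall s, exists2 i, i < m & lab i = Some s) -> connected_graph G.
Proof.
move=> labS; have to_hub (u : G) : connect (@adj G) (inl None) u.
  have to_rim i : connect (@adj G) (inl None) (inr i) by apply: connect1.
  case: u => [[s|]|i] //; have [i lti labi] := labS s.
  apply: connect_trans (to_rim (Ordinal lti)) (connect1 _).
  by rewrite /= labi.
move=> u v; apply: connect_trans (to_hub v).
by rewrite (sym_connect_sym (@adj_sym G)).
Qed.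

End HubDomination.

(** * Perfect domination in hub graphs *)

Section HubPerfect.
Variables (m : nat) (h : rel nat) (lab : nat -> option bool).
Local Notation G := (hub_graph m h lab).
Local Notation hset P W := (@hub_set m h lab P W).

Lemma focal_perfect z : z < m -> focal m h lab z ->
  exists2 S : {set G}, perfect_dominating S & #|S| = 3.
Proof.
move=> ltz /focalP foc.
have cz b : count (fun j => b j && (j == z)) (iota 0 m) = b z by apply: count_at.
exists (hset (predC1 None) (pred1 z)).
  apply/perfect_dominatingP; split=> [|s|i lti]; first by right; apply: (cz predT).
    by left.
  have [->|iz] := eqVneq i z; [by left; apply/eqP | right].
  by rewrite /rim_degree cz linkC foc //=; case: (lab i) => [[]|].
by rewrite card_hub_set (cz predT).
Qed.

Lemma admissible_perfect W : admissible m h lab W ->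
  exists2 S : {set G}, perfect_dominating S & #|S| = weight m lab W.
Proof.
case/admissibleP=> clW cntW.
pose P o := if o is Some s then lab_count m lab W s != 1 else true.
exists (hset P W); last by rewrite card_hub_set.
apply/perfect_dominatingP; split=> [|s|i lti]; first by left.
  by rewrite /P; case: eqP => ?; [right | left].
case Wi: (W i); [by left | right].
rewrite /rim_degree (@eq_in_count _ _ pred0) ?count_pred0 => [|j]; last first.
  rewrite mem_iota => /= ltj; apply/negP => /andP[lij Wj].
  by rewrite (clW i j) // Wj in Wi.
have noP s : (lab i == Some s) && P (Some s) = false.
  apply/negP => /andP[/eqP labi]; rewrite /P.
  by case: (cntW s) => [->|/(_ i lti labi)] //; rewrite Wi.
by rewrite !noP.
Qed.

(** Classification of the perfect dominating sets S.  If the hub is in S, it is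
    the only neighbour in S of a rim vertex outside S, so the rim part is closed
    under links.  If not, S has a single rim vertex i; were some pole outside S,
    i would be attached to it, S would be i and the other pole, and
    [side_missed] would yield an undominated vertex.  So both poles are in S
    and i is focal. *)
Lemma perfect_weight (S : {set G}) : side_missed m h lab -> perfect_dominating S ->
  has (focal m h lab) (iota 0 m) \/
  exists2 W, admissible m h lab W & weight m lab W <= #|S|.
Proof.
move=> side; have [P [W ->]] : exists P W, S = hset P W.
  by do 2!eexists; apply: hub_setE.
case/perfect_dominatingP=> dN dS dW.
case PN: (P None).
  right; exists W; last first.
    rewrite /weight card_hub_set PN.
    have bnd s : (lab_count m lab W s != 1) <= P (Some s).
      by case: (dS s) => [->|->] //; case: (_ != _).
    by rewrite leq_add2r !leq_add // bnd.
  have out i : i < m -> ~~ W i ->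
      (forall j, j < m -> link h i j -> ~~ W j) /\
      (forall s, lab i = Some s -> ~~ P (Some s)).
    move=> lti nWi; have [Wi|] := dW i lti; first by rewrite Wi in nWi.
    rewrite /rim_degree PN => deg; split=> [j ltj lij|s labi]; apply/negP => nb.
      suff: 0 < count (fun j => link h i j && W j) (iota 0 m) by lia.
      by rewrite -has_count; apply/has_iotaP; exists j => //; rewrite lij.
    by move: deg; rewrite labi; case: s nb {labi} => /= ->; rewrite ?addnS.
  apply/admissibleP; split=> [i j lti ltj lij|s].
    case Wi: (W i); case Wj: (W j) => //.
      have [nb _] := out j ltj (negbT Wj).
      by have := nb i lti; rewrite linkC lij Wi => /(_ isT).
    have [nb _] := out i lti (negbT Wi).
    by have := nb j ltj lij; rewrite Wj.
  have [Ps|] := dS s; [right=> i lti labi | by left].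
  by apply/idPn => /(out i lti)[_ /(_ s labi)]; rewrite Ps.
have {dN} cW : count W (iota 0 m) = 1 by case: dN; rewrite ?PN.
have [i lti Wi] : exists2 i, i < m & W i by apply: count_gt0P; rewrite cW.
have Wuniq j : j < m -> W j -> j = i.
  move=> ltj Wj; have [//|ji] := eqVneq j i.
  suff: 1 < count W (iota 0 m) by rewrite cW.
  apply: (@count_ge m [:: j; i]) => /= [|w].
    by rewrite inE ji.
  by rewrite !inE => /orP[] /eqP->.
have WE j : j < m -> W j = (j == i).
  by move=> ltj; apply/idP/eqP => [/(Wuniq j ltj)|->].
have poleP s : P (Some s) \/ lab i = Some s.
  have [|cs] := dS s; [by left | right].
  have [|j ltj /andP[/eqP labj Wj]] := @count_gt0P m (fun j => (lab j == Some s) && W j).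
    by rewrite -/(lab_count m lab W s) cs.
  by rewrite -(Wuniq j ltj Wj).
have allP s : P (Some s).
  case: (poleP s) => // labi; apply/idPn => nPs.
  have [z [ltz zi niz labz]] := side_missedP _ _ _ side i s lti labi.
  have [|degz] := dW z ltz; first by rewrite WE // (negPf zi).
  have /rim_degree_gt0 : 0 < rim_degree m h lab P W z by rewrite degz.
  case=> [|[s' labz' Ps']|[w [ltw zw /(Wuniq w ltw) wi]]]; first by rewrite PN.
    by move: labz; rewrite labz'; case: (s) (s') nPs Ps' => [] [] // /negPf->.
  by rewrite linkC -wi zw in niz.
left; apply/has_iotaP; exists i => //; apply/focalP => t ltt ti.
have [|] := dW t ltt; first by rewrite WE // (negPf ti).
rewrite /rim_degree PN !allP.
rewrite (@eq_in_count _ _ (fun j => link h t j && (j == i))) => [|j]; last first.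
  by rewrite mem_iota => /= ltj; rewrite WE.
by rewrite count_at // linkC; case: (lab t) (link h i t) => [[]|] [].
Qed.

End HubPerfect.

(** * Hub form of the extremal graphs *)

Lemma hub_missed m h lab :
  (forall x y : hub_graph m h lab,
     exists z, [/\ z != x, z != y, ~~ adj x z & ~~ adj y z]) ->
  side_missed m h lab && cross_missed m h lab.
Proof.
move=> pairs; apply/andP; split.
  apply/side_missedP => y s lty laby.
  have [[[s'|]|z] [] //=] := pairs (inl (Some (~~ s))) (inr (Ordinal lty)).
    move=> zs _ _; rewrite laby; case: s s' zs {laby} => [] [] //=.
  by move=> _ zy labz nyz; exists z; split=> //; rewrite ltn_ord.
apply/cross_missedP => x y ltx lty labx laby.
have [[[[]|]|z] [] //=] := pairs (inr (Ordinal ltx)) (inr (Ordinal lty)).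
- by rewrite labx.
- by rewrite laby.
- by move=> zx zy nxz nyz; exists z; split=> //; rewrite ltn_ord.
Qed.

Fixpoint bitseqs n : seq bitseq :=
  if n is n'.+1 then [seq b :: s | b <- [:: true; false], s <- bitseqs n']
  else [:: [::]].

Fixpoint tables n : seq (seq bitseq) :=
  if n is n'.+1 then [seq rcons t r | t <- tables n', r <- bitseqs n']
  else [:: [::]].

(** The rim graph is stored as the list, for each j, of the adjacencies of j to
    the i < j, so that all graphs on m vertices can be enumerated. *)
Definition table m (g : rel nat) := mkseq (fun j => mkseq (g^~ j) j) m.

Definition lookup (t : seq bitseq) : rel nat :=
  fun i j => nth false (nth [::] t j) i.

Lemma mem_bitseqs s : s \in bitseqs (size s).
Proof.
elim: s => //= b s IHs; rewrite cats0 mem_cat.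
by case: b; rewrite map_f ?orbT.
Qed.

Lemma mem_tables m g : table m g \in tables m.
Proof.
elim: m => //= m IHm; rewrite /table mkseqS; apply: allpairs_f => //.
by rewrite -[X in bitseqs X](size_mkseq (g^~ m)) mem_bitseqs.
Qed.

Lemma link_table m g i j :
  i < m -> j < m -> link (lookup (table m g)) i j = link g i j.
Proof.
have lookE a b : a < b -> b < m -> lookup (table m g) a b = g a b.
  by move=> ltab ltb; rewrite /lookup !nth_mkseq.
move=> lti ltj; rewrite /link; congr (_ || _).
  by case: ltnP => // /lookE->.
by case: ltnP => // /lookE->.
Qed.

(** The rim is listed with the p neighbours of the first pole first and the q
    neighbours of the second next, which leaves few labellings. *)
Definition sorted_label p q i :=
  if i < p then Some true else if i < p + q then Some false else None.

Lemma connected_nbh (G : sgraph) (u v : G) :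
  connected_graph G -> u != v -> 0 < #|nbh u|.
Proof.
move=> conG uv; have /connectP[[|w s] /= uws] := conG u v.
  by move=> vu; rewrite vu eqxx in uv.
by move=> _; apply/card_gt0P; exists w; rewrite inE; case/andP: uws.
Qed.

(** The pairs {v, x} do not dominate, where v has degree m and x is any vertex.
    With x a pole this says that the poles are not adjacent, and with x a
    neighbour of a pole that x is not a neighbour of the other one.  Both poles
    have neighbours since G is connected. *)
Lemma hub_normal_form (G : sgraph) m :
  connected_graph G -> #|G| = m + 3 -> max_degree G = m -> gamma G = 3 ->
  exists p q t (phi : hub_graph m (lookup t) (sorted_label p q) -> G),
    [/\ 0 < p, 0 < q, p + q <= m & t \in tables m] /\
    (bijective phi /\ {mono phi : x y / adj x y}).
Proof.
move=> conG cG maxG gamG; have pairG x y := @pair_not_dominating G x y.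
rewrite gamG in pairG.
have [v degv] : exists v : G, #|nbh v| = m.
  have [|v] := @eq_bigmax _ (fun v : G => #|nbh v|); first by rewrite cG addnS.
  by rewrite -/(max_degree G) maxG => ->; exists v.
have nvv : v \notin nbh v by rewrite inE adj_irrefl.
have /eqP/cards2P[a [b [ab far]]] : #|~: (v |: nbh v)| = 2.
  by have := cardsC (v |: nbh v); rewrite cardsU1 nvv cG degv; lia.
have farE x : (x == a) || (x == b) = (x != v) && ~~ adj v x.
  by have /setP/(_ x) := far; rewrite !inE negb_or => ->.
have [av nva] : a != v /\ ~~ adj v a by apply/andP; rewrite -farE eqxx.
have [bv nvb] : b != v /\ ~~ adj v b by apply/andP; rewrite -farE eqxx orbT.
have nab : ~~ adj a b.
  have [z [zv za nvz naz]] := pairG v a isT.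
  by have := farE z; rewrite zv nvz (negPf za) => /eqP <-.
have dis x : adj a x -> ~~ adj b x.
  have [z [zv zx nvz nxz]] := pairG v x isT; move=> ax.
  have := farE z; rewrite zv nvz => /orP[]/eqP zE.
    by rewrite zE adj_sym ax in nxz.
  by rewrite adj_sym -zE.
have near c x : (c == a) || (c == b) -> adj c x -> adj v x.
  move=> cab cx; apply: contraTT cx => nvx.
  have [->|xv] := eqVneq x v; first by rewrite adj_sym; case/orP: cab => /eqP->.
  have := farE x; rewrite xv nvx => /orP[] /eqP->.
    by case/orP: cab => /eqP->; rewrite ?adj_irrefl // adj_sym.
  by case/orP: cab => /eqP->; rewrite ?adj_irrefl.
pose xs := enum (nbh a) ++ enum (nbh b) ++
           enum (nbh v :\: (nbh a :|: nbh b)).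
have mem_xs x : (x \in xs) = adj v x.
  rewrite !mem_cat !mem_enum !inE; case ax: (adj a x) => /=.
    by rewrite (near a) ?eqxx.
  by case bx: (adj b x) => //=; rewrite (near b) ?eqxx ?orbT.
have uniq_xs : uniq xs.
  rewrite !cat_uniq !enum_uniq /= andbT; apply/andP; split.
    apply/hasPn => x; rewrite mem_cat !mem_enum !inE.
    by case/orP=> [bx|/andP[]]; [apply: contraL bx; apply: dis | case: adj].
  by apply/hasPn => x; rewrite !mem_enum !inE; case: (adj b x); rewrite ?orbT.
have size_xs : size xs = m.
  rewrite -degv; transitivity #|xs|; first exact/esym/card_uniqP.
  by apply: eq_card => x; rewrite mem_xs inE.
set p := #|nbh a|; set q := #|nbh b|; pose x i := nth v xs i.
have vx i : i < m -> adj v (x i) by rewrite -size_xs -mem_xs => /(mem_nth v).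
have labE i : i < m -> sorted_label p q i =
    if adj a (x i) then Some true else if adj b (x i) then Some false else None.
  move=> lti; rewrite /sorted_label /x /xs !nth_cat -!cardE -/p -/q.
  have [ltip|lepi] := ltnP i p.
    by have := mem_nth v (s := enum (nbh a)); rewrite -cardE => /(_ i ltip);
      rewrite mem_enum inE => ->.
  have [ltiq|leqi] := ltnP (i - p) q.
    have := mem_nth v (s := enum (nbh b)); rewrite -cardE => /(_ _ ltiq).
    rewrite mem_enum inE => bx; rewrite bx.
    case ax: (adj a _); first by have := dis _ ax; rewrite bx.
    by rewrite ifT //; move: ltiq lepi; clear; lia.
  rewrite ifF; last by move: leqi lepi; clear; lia.
  have := @mem_nth _ v (enum (nbh v :\: (nbh a :|: nbh b))) (i - p - q).
  rewrite -cardE mem_enum !inE negb_or => mem_C.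
  have /mem_C/andP[/andP[/negPf-> /negPf->] _ //] :
    i - p - q < #|nbh v :\: (nbh a :|: nbh b)|.
  move: lti; rewrite -{1}size_xs !size_cat -!cardE -/p -/q.
  by move: leqi lepi; clear; lia.
pose g : rel nat := fun i j => adj (x i) (x j).
pose phi (u : hub_vertex m) : G :=
  match u with
  | inl None => v
  | inl (Some s) => if s then a else b
  | inr i => x i
  end.
exists p, q, (table m g), phi; split; first split.
- by apply: connected_nbh conG av.
- by apply: connected_nbh conG bv.
- by rewrite -size_xs !size_cat -!cardE addnA leq_addr.
- exact: mem_tables.
split; last first.
  have adjE s (i : 'I_m) : adj (if s then a else b) (x i) = (sorted_label p q i == Some s).
    rewrite labE //; case: s.
      by case: (adj a _) => //; case: (adj b _).
    case ax: (adj a _); first by rewrite (negPf (dis _ ax)).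
    by case: (adj b _).
  case=> [[s|]|i] [[s'|]|j] //=.
  + case: s s' => [] []; rewrite ?adj_irrefl ?(negPf nab) //.
    by rewrite adj_sym (negPf nab).
  + by case: s; rewrite adj_sym ?(negPf nva) ?(negPf nvb).
  + by case: s'; rewrite ?(negPf nva) ?(negPf nvb).
  + by rewrite adj_irrefl.
  + exact: vx.
  + by rewrite adj_sym adjE.
  + by rewrite adj_sym vx.
  + rewrite link_table // /link /g; case: ltngtP => [_|_|/ord_inj ->] //=.
    * by rewrite orbF.
    * by rewrite adj_sym.
    * by rewrite adj_irrefl.
apply: inj_card_bij; last first.
  by rewrite card_sum card_option card_bool card_ord cG addnC.
have inl_far o : ~~ adj v (phi (inl o)).
  by case: o => [[]|] //; rewrite adj_irrefl.
have inl_inr o (i : 'I_m) : phi (inl o) <> x i.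
  by move=> ox; have := inl_far o; rewrite ox vx.
case=> [o|i] [o'|j]; try by move=> /= /inl_inr.
- case: o o' => [[]|] [[]|] //= oo'; move: ab av bv; rewrite ?oo' ?eqxx //.
- by move=> /esym/inl_inr.
- move/eqP; rewrite /= /x nth_uniq ?size_xs // => /eqP/ord_inj ->//.
Qed.

(** * Orders six, seven and eight *)

Definition small_check m k p q t :=
  let h := lookup t in let lab := sorted_label p q in
  side_missed m h lab && cross_missed m h lab ==>
  ((3 <= k) && has (focal m h lab) (iota 0 m)) ||
  has (fun w => admissible m h lab (nth false w)
                && (weight m lab (nth false w) <= k)) (bitseqs m).

Definition small_checks m k :=
  all (fun p => all (fun q => all (small_check m k p q) (tables m))
                    (iota 1 (m - p))) (iota 1 m).

(** The check ranges over all hub forms of a graph with m rim vertices; a focal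
    vertex or an admissible part found in the hub form gives a perfect dominating
    set of G through the isomorphism. *)
Lemma small_gamma11 (G : sgraph) m k :
  connected_graph G -> #|G| = m + 3 -> max_degree G = m -> gamma G = 3 ->
  small_checks m k -> gamma11 G <= k.
Proof.
move=> conG cG maxG gamG /allP chk.
have [p [q [t [phi [[p0 q0 pq tm] [bij mono]]]]]] := hub_normal_form conG cG maxG gamG.
have /chk/allP/(_ q) : p \in iota 1 m by rewrite mem_iota; lia.
have -> : q \in iota 1 (m - p) by rewrite mem_iota; lia.
move=> /(_ isT)/allP/(_ t tm); rewrite /small_check hub_missed; last first.
  move=> u w; have [|z [zu zw nuz nwz]] := pair_not_dominating (phi u) (phi w).
    by rewrite gamG.
  have [psi phiK psiK] := bij; exists (psi z).
  by rewrite -!mono psiK !(can2_eq psiK phiK); split.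
case/orP=> [/andP[k3 /has_iotaP[z ltz foc]]|/hasP[w _ /andP[adm wk]]].
  have [S perS cS] := focal_perfect ltz foc.
  by apply: leq_trans (gamma11_transport_le bij mono perS) _; rewrite cS.
have [S perS cS] := admissible_perfect adm.
by apply: leq_trans (gamma11_transport_le bij mono perS) _; rewrite cS.
Qed.

(* [lazy] rather than [vm_compute]: with call by value the search for W would
   also run on the many tables that fail the hypotheses. *)
Lemma small_checks_3 : small_checks 3 3. Proof. by lazy. Qed.
Lemma small_checks_4 : small_checks 4 4. Proof. by lazy. Qed.
Lemma small_checks_5 : small_checks 5 7. Proof. by lazy. Qed.

(** * Constructions *)

Lemma gamma11_hub m h lab k :
  side_missed m h lab -> ~~ has (focal m h lab) (iota 0 m) ->
  (exists2 W, admissible m h lab W & weight m lab W <= k) ->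
  (forall W, admissible m h lab W -> k <= weight m lab W) ->
  gamma11 (hub_graph m h lab) = k.
Proof.
move=> side nofoc [W0 adm0 le0] minW; apply/eqP; rewrite eqn_leq.
apply/andP; split.
  by have [S /gamma11_le leS cS] := admissible_perfect adm0; rewrite cS in leS;
    apply: leq_trans le0.
have [S perS <-] := gamma11_witness (hub_graph m h lab).
have [foc|[W /minW leW]] := perfect_weight side perS.
  by rewrite foc in nofoc.
exact: leq_trans leW.
Qed.

(** A pole outside has one neighbour in W, a pole inside has all of them, hence
    at least one in either case. *)
Lemma admissible_meets m h lab W i s :
  admissible m h lab W -> i < m -> lab i = Some s ->
  exists j, [/\ j < m, lab j = Some s & W j].
Proof.
case/admissibleP=> _ /(_ s)[cs|subW] lti labi; last first.
  by exists i; split=> //; apply: subW.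
have [|j ltj /andP[/eqP labj Wj]] :=
    @count_gt0P m (fun j => (lab j == Some s) && W j).
  by rewrite -/(lab_count m lab W s) cs.
by exists j.
Qed.

Definition realizable k n :=
  exists G : sgraph,
     [/\ connected_graph G, #|G| = n, max_degree G = n - 3,
         gamma G = 3 & gamma11 G = k].

Lemma hub_realizes m h lab k :
  side_missed m h lab -> cross_missed m h lab ->
  (forall s, exists2 i, i < m & lab i = Some s) ->
  gamma11 (hub_graph m h lab) = k -> realizable k (m + 3).
Proof.
move=> side cross labS gk; exists (hub_graph m h lab); split=> //.
- exact: connected_hub.
- by rewrite card_sum card_option card_bool card_ord addnC.
- by rewrite max_degree_hub // addnK.
- exact: gamma_hub.
Qed.

(** A star with centre 0 on the rim vertices below s, plus the edge from 1 to t;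
    there is no such edge when t <= 1.  [broom m.-1 m.-1] is the spider
    whose long leg is 0, 1, m.-1. *)
Definition broom s t : rel nat :=
  fun i j => (i == 0) && (j < s) || (i == 1) && (j == t).

Lemma realizable_3 m : 3 <= m -> realizable 3 (m + 3).
Proof.
move=> m3; pose h := broom 0 0.
pose lab i := if i == 0 then Some true else if i == 1 then None else Some false.
have nolink i j : link h i j = false by rewrite /link /h /broom; lia.
have side : side_missed m h lab.
  apply/side_missedP => y s lty laby; exists 1; rewrite nolink; split=> //.
    by lia.
  by apply/eqP => y1; rewrite -y1 in laby.
have cross : cross_missed m h lab.
  apply/cross_missedP => x y _ _ labx laby; exists 1; rewrite !nolink.
  split=> //; first by lia.
    by apply/eqP => x1; rewrite -x1 in labx.
  by apply/eqP => y1; rewrite -y1 in laby.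
apply: (hub_realizes side cross) => [[]|].
- by exists 0 => //; lia.
- by exists 2 => //; lia.
apply/eqP; rewrite eqn_leq -{2}(gamma_hub side cross) gamma_le_gamma11 andbT.
have [||S perS <-] := @focal_perfect m h lab 1; [by lia | | exact: gamma11_le].
apply/focalP => t _ t1; rewrite nolink /lab (negPf t1).
by case: (t == 0).
Qed.

(** The poles are attached to 0 and 2 only, and the component of 0 is
    {0, ..., k - 2}, so this set is the lightest admissible part, of weight
    1 + (k - 1).  The vertex m - 1 is unlabelled and linked to neither 0 nor 2,
    so it is missed in all the pairs to consider.  For k = m + 1 the component
    is the whole rim; with a star 0 would dominate it, hence the spider. *)
Lemma realizable_component m k s t :
  3 < k ->
  k <= m /\ s = k.-1 /\ t = 0 \/
    5 <= m /\ k = m.+1 /\ s = m.-1 /\ t = m.-1 ->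
  realizable k (m + 3).
Proof.
move=> k3 par; pose h := broom s t.
pose lab i := if i == 0 then Some true else if i == 2 then Some false else None.
have m4 : 3 < m by lia.
have lab_t i : lab i = Some true -> i = 0.
  by rewrite /lab; case: eqP => // _; case: eqP.
have lab_f i : lab i = Some false -> i = 2.
  by rewrite /lab; case: eqP => // _; case: eqP.
have lab_s i r : lab i = Some r -> i = 0 \/ i = 2.
  by case: r => [/lab_t|/lab_f]; [left | right].
have lab_last : lab m.-1 = None by rewrite /lab !ifF //; lia.
have nlink2 i : i = 0 \/ i = 2 -> ~~ link h i m.-1.
  by rewrite /link /h /broom; lia.
have side : side_missed m h lab.
  apply/side_missedP => y r _ /lab_s y02; exists m.-1.
  by rewrite lab_last nlink2 //; split=> //; lia.
have cross : cross_missed m h lab.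
  apply/cross_missedP => x y _ _ /lab_s x02 /lab_s y02; exists m.-1.
  by rewrite !nlink2 //; split=> //; lia.
have nofoc : ~~ has (focal m h lab) (iota 0 m).
  apply/has_iotaP => -[z ltz /focalP foc].
  have {}foc a : a < m -> a != z -> link h z a = (a != 0) && (a != 2).
    by move=> lta az; rewrite foc // /lab; case: (a == 0); case: (a == 2).
  have [z0|z0] := eqVneq z 0.
    by have := foc m.-1; rewrite z0 /link /h /broom; clear -par k3 m4; lia.
  have lesz : s <= z.
    by have := foc 0; rewrite /link /h /broom; clear -m4 z0; lia.
  (* z is now outside the star: isolated, or the end of the long leg, while 1
     and 3 are unlabelled and one of them is not linked to z. *)
  have := foc 1; have := foc 3.
  by rewrite /link /h /broom; clear -par k3 m4 ltz lesz; lia.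
apply: (hub_realizes side cross) => [[]|].
- by exists 0 => //; lia.
- by exists 2 => //; lia.
apply: (gamma11_hub side nofoc).
  pose W i := i < k.-1; exists W.
    apply/admissibleP; split=> [i j lti ltj|[]].
    - by rewrite /W /link /h /broom => lij; apply/idP/idP; lia.
    - by right=> i _ /lab_t->; rewrite /W; lia.
    - by right=> i _ /lab_f->; rewrite /W; lia.
  have lc b z : lab z = Some b -> (forall i, lab i = Some b -> i = z) ->
      W z -> z < m -> lab_count m lab W b = 1.
    move=> labz labP Wz ltz; rewrite /lab_count.
    rewrite (@eq_count _ _ (fun j => W j && (j == z))) => [|j].
      by rewrite count_at // Wz.
    rewrite andbC; congr (_ && _); apply/eqP/eqP => [/labP //|->//].
  rewrite /weight (lc true 0) ?(lc false 2) //; try (rewrite /W; lia).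
  have -> : count W (iota 0 m) = k.-1; last by rewrite /=; lia.
  rewrite -size_filter /W -[k.-1]add0n filter_iota_ltn ?size_iota ?add0n //.
  by lia.
move=> W adm; have [clW _] := admissibleP _ _ _ _ adm.
have W0 : W 0.
  have lt0m : 0 < m by lia.
  by have [j [_ /lab_t-> //]] := admissible_meets (s := true) adm lt0m erefl.
have Ws i : i < m -> i < s -> W i.
  case: i => // i lti ltis; rewrite -(clW 0 i.+1) //; first by lia.
  by rewrite /link /h /broom ltis.
rewrite /weight -[k](prednK (ltn_trans _ k3)) // -addn1 addnC.
apply: leq_add; first by rewrite -!addnA leq_addr.
rewrite -{1}(size_iota 0 k.-1); apply: count_ge; first exact: iota_uniq.
move=> i; rewrite mem_iota => ltik; have lti : i < m by lia.
split=> //; have [ltis|leis] := ltnP i s; first exact: Ws.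
rewrite -(clW 1 i) //; first by apply: Ws; lia.
  by lia.
by rewrite /link /h /broom; lia.
Qed.

Section Spider.
Variable m : nat.
Hypothesis m5 : 5 <= m.
Local Notation spider := (broom m.-1 m.-1).

Lemma spider_admissible_full lab W i :
  admissible m spider lab W -> i < m -> W i -> forall j, j < m -> W j.
Proof.
case/admissibleP=> clW _; suff W0 j : j < m -> W j = W 0.
  by move=> lti Wi j ltj; rewrite W0 // -(W0 i).
have W0' a : a < m.-1 -> W a = W 0.
  case: a => // a lta; apply: clW; [lia | lia | rewrite /link /broom; lia].
move=> ltj; have [/W0'//|lej] := ltnP j m.-1.
rewrite -(W0' 1); last by lia.
by apply: clW; [lia | lia | rewrite /link /broom; lia].
Qed.

End Spider.

(** The vertex m - 1 is the only unlabelled one and the first pole is attached to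
    the leaf 2 only, so the lightest perfect dominating set omits exactly that
    pole. *)
Lemma realizable_all_but_one m : 5 <= m -> realizable m.+2 (m + 3).
Proof.
move=> m5; pose h := broom m.-1 m.-1.
pose lab i :=
  if i == 2 then Some true else if i == m.-1 then None else Some false.
have lab_t i : lab i = Some true -> i = 2.
  by rewrite /lab; case: eqP => // _; case: eqP.
have lab_f i : i != 2 -> i != m.-1 -> lab i = Some false.
  by rewrite /lab => /negPf-> /negPf->.
have lab_last : lab m.-1 = None by rewrite /lab ifF ?eqxx //; lia.
have lab_s i r : lab i = Some r -> i != m.-1 /\ (i = 2 -> r = true).
  rewrite /lab; case: eqP => [-> [<-]|i2]; first by split=> //; lia.
  by case: eqP => // _ _; split=> // /i2.
have side : side_missed m h lab.
  apply/side_missedP => y r lty laby; have [ym y2] := lab_s y r laby.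
  have [/y2 rt|yn2] := eqVneq y 2; last move: laby; rewrite ?lab_f //.
    exists m.-1; rewrite lab_last; split=> //; try lia.
    by move: (lab_t y); rewrite laby rt => ->//; rewrite /link /h /broom; lia.
  case=> <-; have [y1|yn1] := eqVneq y 1.
    exists 3; split; rewrite ?lab_f //; try lia.
    by rewrite /link /h /broom; lia.
  have [y0|yn0] := eqVneq y 0.
    exists m.-1; rewrite lab_last; split=> //; try lia.
    by rewrite /link /h /broom; lia.
  exists 1; split; rewrite ?lab_f //; try lia.
  by rewrite /link /h /broom; lia.
have cross : cross_missed m h lab.
  apply/cross_missedP => x y ltx lty /lab_t-> laby.
  have [ym y2] := lab_s y _ laby.
  have {}y2 : y != 2 by apply/eqP=> /y2.
  have [y1|yn1] := eqVneq y 1.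
    by exists 3; split; rewrite /link /h /broom; lia.
  by exists m.-1; split; rewrite /link /h /broom; lia.
have nofoc : ~~ has (focal m h lab) (iota 0 m).
  apply/has_iotaP => -[z ltz /focalP foc].
  have {}foc a : a < m -> a != z -> link h z a = (a == m.-1).
    move=> lta az; rewrite foc // /lab; have [->|_] := eqVneq a 2.
      by apply/esym/negbTE; lia.
    by case: (a == m.-1).
  have := foc 0; have := foc 1; have := foc 2.
  by rewrite /link /h /broom; clear -m5 ltz; lia.
apply: (hub_realizes side cross) => [[]|].
- by exists 2 => //; lia.
- by exists 0; rewrite ?lab_f //; lia.
apply: (gamma11_hub side nofoc).
  exists predT; first by apply/admissibleP; split=> // s; right.
  rewrite /weight count_predT size_iota.
  have -> : lab_count m lab predT true = 1.
    rewrite /lab_count (@eq_count _ _ (fun j => true && (j == 2))) => [|j].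
      by rewrite (@count_at m predT) //; lia.
    by rewrite andbT; apply/eqP/eqP => [/lab_t|->].
  by case: (lab_count m lab predT false != 1) => /=; lia.
move=> W adm.
have lt2m : 2 < m by lia.
have [j [ltj _ Wj]] := admissible_meets (s := true) adm lt2m erefl.
have allW := spider_admissible_full m5 adm ltj Wj.
have -> : m.+2 = 1 + 0 + 1 + m by lia.
rewrite /weight !leq_add //.
  suff: 1 < lab_count m lab W false by case: (lab_count _ _ _ _) => [|[]].
  apply: (@count_ge m [:: 0; 1]) => // i.
  rewrite !inE => /orP[] /eqP->; (split; first by lia);
    by rewrite lab_f ?allW //; lia.
rewrite -{1}(size_iota 0 m); apply: count_ge; first exact: iota_uniq.
by move=> i; rewrite mem_iota => lti; split=> //; apply: allW.
Qed.

(** The second pole is attached to the two leaves 2 and 3, the first one to all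
    other rim vertices, among them a third leaf 4, whence m >= 6.  Every rim
    vertex is labelled and the rim is connected, so there is no focal vertex;
    both poles have at least two neighbours. *)
Lemma realizable_order m : 6 <= m -> realizable (m + 3) (m + 3).
Proof.
move=> m6; pose h := broom m.-1 m.-1; have m5 : 5 <= m by lia.
pose lab i := if (i == 2) || (i == 3) then Some false else Some true.
have lab_f i : lab i = Some false -> i = 2 \/ i = 3.
  by rewrite /lab; case: ifP => // /orP[] /eqP; [left | right].
have lab_t i : i != 2 -> i != 3 -> lab i = Some true.
  by rewrite /lab => /negPf-> /negPf->.
have lab_T i : lab i = Some true -> i != 2 /\ i != 3.
  by rewrite /lab; case: eqP => // _; case: eqP.
have side : side_missed m h lab.
  apply/side_missedP => y [] lty; last first.
    case/lab_f=> ->; [exists 3 | exists 2].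
      by split=> //; rewrite /link /h /broom; lia.
    by split=> //; rewrite /link /h /broom; lia.
  move=> /lab_T[y2 y3]; have [y0|yn0] := eqVneq y 0.
    exists m.-1; split; rewrite ?lab_t //; try lia.
    by rewrite /link /h /broom; lia.
  have [y1|yn1] := eqVneq y 1.
    exists 4; split; rewrite ?lab_t //; try lia.
    by rewrite /link /h /broom; lia.
  have [ym|ynm] := eqVneq y m.-1.
    exists 0; split; rewrite ?lab_t //; try lia.
    by rewrite /link /h /broom; lia.
  exists 1; split; rewrite ?lab_t //; try lia.
  by rewrite /link /h /broom; lia.
have cross : cross_missed m h lab.
  apply/cross_missedP => x y ltx lty /lab_T[x2 x3] /lab_f y23.
  (* 5 - y is the other neighbour of the second pole. *)
  have [x1|xn1] := eqVneq x 1.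
    by exists (5 - y); split; rewrite /link /h /broom; lia.
  have [xm|xnm] := eqVneq x m.-1.
    by exists 4; split; rewrite /link /h /broom; lia.
  by exists m.-1; split; rewrite /link /h /broom; lia.
have nofoc : ~~ has (focal m h lab) (iota 0 m).
  apply/has_iotaP => -[z ltz /focalP foc].
  have {}foc a : a < m -> a != z -> ~~ link h z a.
    by move=> lta az; rewrite foc // /lab; case: ifP.
  have := foc 0; have := foc 1.
  by rewrite /link /h /broom; clear -m6 ltz; lia.
apply: (hub_realizes side cross) => [[]|].
- by exists 0 => //; lia.
- by exists 2 => //; lia.
apply: (gamma11_hub side nofoc).
  exists predT; first by apply/admissibleP; split=> // s; right.
  rewrite /weight count_predT size_iota [m + 3]addnC leq_add2r.
  by case: (_ != 1); case: (_ != 1).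
move=> W adm; have lt0m : 0 < m by lia.
have [j [ltj _ Wj]] := admissible_meets (s := true) adm lt0m erefl.
have allW := spider_admissible_full m5 adm ltj Wj.
rewrite addnC; apply: (@leq_add 3); last first.
  rewrite -{1}(size_iota 0 m); apply: count_ge; first exact: iota_uniq.
  by move=> i; rewrite mem_iota => lti; split=> //; apply: allW.
have n1 b i1 i2 : i1 != i2 -> i1 < m -> i2 < m -> lab i1 = Some b ->
    lab i2 = Some b -> lab_count m lab W b != 1.
  move=> i12 lt1 lt2 lab1 lab2.
  suff: 1 < lab_count m lab W b by case: (lab_count _ _ _ _) => [|[]].
  apply: (@count_ge m [:: i1; i2]) => /= [|i]; first by rewrite inE i12.
  by rewrite !inE => /orP[] /eqP->; rewrite ?lab1 ?lab2 ?allW ?eqxx.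
by rewrite (n1 true 0 1) ?(n1 false 2 3) //; lia.
Qed.

Theorem theorem4 (k n : nat) (hk : 3 <= k) (hkn : k <= n) (hn : 6 <= n) :
  (exists G : sgraph,
     [/\ connected_graph G, #|G| = n, max_degree G = n - 3,
         gamma G = 3 & gamma11 G = k])
  <-> (k, n) \notin [:: (4, 6); (5, 6); (6, 6); (5, 7); (6, 7); (7, 7); (8, 8)].
Proof.
rewrite !inE !xpair_eqE; split=> [[G [conG cG maxG gamG gk]]|small].
  have bound m c : n = m + 3 -> small_checks m c -> k <= c.
    move=> nm chk; rewrite -gk.
    by apply: (small_gamma11 (m := m)); rewrite // ?cG ?maxG // nm addnK.
  have := @bound 3 3; have := @bound 4 4; have := @bound 5 7.
  rewrite small_checks_3 small_checks_4 small_checks_5.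
  by clear -hk hkn; lia.
rewrite -/(realizable k n) -(@subnK 3 n); last by lia.
set m := n - 3; have nm : n = m + 3 by rewrite /m; lia.
have [->|k3] := eqVneq k 3; first by apply: realizable_3; lia.
have [km|km] := leqP k m; first by apply: (@realizable_component m k k.-1 0); lia.
have [k1|k1] := eqVneq k m.+1.
  by apply: (@realizable_component m k m.-1 m.-1); lia.
have [->|k2] := eqVneq k m.+2; first by apply: realizable_all_but_one; lia.
have -> : k = m + 3 by lia.
by apply: realizable_order; lia.
Qed.
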